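(* Let $(S,\cdot,\ast)$ be a regular $\star$-semigroup. Define binary operations $+$ and $\oplus$ on $S$ by $a+b=b^{\ast}a$ and $a\oplus b=ba^{\ast}$ for all $a,b\in S$. Then the following hold. (1) $(S,+)$ is a semigroup if and only if $x=x^{\ast}$ for all $x\in S$. Likewise, $(S,\oplus)$ is a semigroup if and only if $x=x^{\ast}$ for all $x\in S$. (2) The identity $(z+y)x=(z+x^{\ast})x+yx$ holds for all $x,y,z\in S$ if and only if $(S,\cdot)$ is commutative. Likewise, the identity $x(y\oplus z)=xy\oplus x(x^{\ast}\oplus z)$ holds for all $x,y,z\in S$ if and only if $(S,\cdot)$ is commutative. (3) If $x(y+z)=xy+x(x^{\ast}+z)$ for all $x,y,z\in S$, then $(S,\cdot,\ast)$ is completely regular, orthodox and locally inverse. Likewise, if $(z\oplus y)x=(z\oplus x^{\ast})x\oplus yx$ for all $x,y,z\in S$, then $(S,\cdot,\ast)$ is completely regular, orthodox and locally inverse. (4) If $x=x^{\ast}$ for all $x\in S$, then $(S,\cdot)$ is commutative, and $x(y+z)=xy+x(x^{\ast}+z)$ and $(z\oplus y)x=(z\oplus x^{\ast})x\oplus yx$ hold for all $x,y,z\in S$. Thus $(S,+,\cdot,\ast)$ is a left (or equivalently, right; or equivalently, two-sided) regular $\star$-semibrace if and only if $x=x^{\ast}$ for all $x\in S$, and the same holds for $(S,\oplus,\cdot,\ast)$.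
   Context: A regular $\star$-semigroup is a triple $(S,\cdot,\ast)$ where $(S,\cdot)$ is a semigroup on a non-empty set and $\ast:S\to S$, $x\mapsto x^\ast$, satisfies $xx^\ast x=x$, $(x^\ast)^\ast=x$, $(xy)^\ast=y^\ast x^\ast$ for all $x,y\in S$. It is called completely regular if $a\,\mathcal H\,a^2$ for all $a\in S$ ($\mathcal H=\mathcal L\cap\mathcal R$ being Green's relation), orthodox if the product of any two idempotents is idempotent, and locally inverse if $eSe$ is an inverse semigroup for every idempotent $e$. Let $(S,+,\cdot,\ast)$ be such that $(S,+)$ is a semigroup and $(S,\cdot,\ast)$ is a regular $\star$-semigroup. It is a left regular $\star$-semibrace if $x(y+z)=xy+x(x^{\ast}+z)$ for all $x,y,z\in S$; a right regular $\star$-semibrace if $(z+y)x=(z+x^{\ast})x+yx$ for all $x,y,z\in S$; two-sided if both hold. Multiplication has precedence over addition. The same terminology is used with $\oplus$ in place of $+$. *)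

(* Defs.v *)
From mathcomp Require Import all_boot.

Set Implicit Arguments.
Unset Strict Implicit.
Unset Printing Implicit Defensive.

(* Semigroups are operations on an arbitrary type rather than [semigroupType]s:
   several unrelated operations live on one carrier, being a semigroup is a
   property of such an operation, and the carrier need not be a choiceType. *)

Section Semigroups.
Variables (S : Type) (mul : S -> S -> S).
Local Notation "x * y" := (mul x y).

Definition is_semigroup : Prop := inhabited S /\ associative mul.

Definition idempotent_elt (e : S) : Prop := e * e = e.

(* S^1 a and a S^1 *)
Definition left_ideal1 (a x : S) : Prop := x = a \/ exists s, x = s * a.
Definition right_ideal1 (a x : S) : Prop := x = a \/ exists s, x = a * s.

Definition greenL (a b : S) : Prop :=
  forall x, left_ideal1 a x <-> left_ideal1 b x.
Definition greenR (a b : S) : Prop :=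
  forall x, right_ideal1 a x <-> right_ideal1 b x.
Definition greenH (a b : S) : Prop := greenL a b /\ greenR a b.

Definition completely_regular : Prop := forall a, greenH a (a * a).

Definition orthodox : Prop :=
  forall e f, idempotent_elt e -> idempotent_elt f -> idempotent_elt (e * f).

Definition inverse_of (a b : S) : Prop := a * b * a = a /\ b * a * b = b.

(* The subset T is an inverse semigroup under the restriction of mul; inverses
   are sought, and required to be unique, inside T. *)
Definition inverse_subsemigroup (T : S -> Prop) : Prop :=
  [/\ exists a, T a,
      forall a b, T a -> T b -> T (a * b) &
      forall a, T a -> exists! b, T b /\ inverse_of a b].

(* e S e *)
Definition local_subset (e x : S) : Prop := exists s, x = e * s * e.

Definition locally_inverse : Prop :=
  forall e, idempotent_elt e -> inverse_subsemigroup (local_subset e).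

End Semigroups.

Section StarSemigroups.
Variables (S : Type) (mul : S -> S -> S) (star : S -> S).
Local Notation "x * y" := (mul x y).
Local Notation "x ^*" := (star x).

Definition regular_star_semigroup : Prop :=
  [/\ is_semigroup mul,
      forall x, x * x^* * x = x,
      involutive star &
      forall x y, (x * y)^* = y^* * x^*].

Definition star_add (a b : S) : S := b^* * a.
Definition star_oplus (a b : S) : S := b * a^*.

End StarSemigroups.

Section Semibraces.
Variables (S : Type) (add mul : S -> S -> S) (star : S -> S).
Local Notation "x + y" := (add x y).
Local Notation "x * y" := (mul x y).
Local Notation "x ^*" := (star x).

Definition left_semibrace_law : Prop :=
  forall x y z, x * (y + z) = x * y + x * (x^* + z).
Definition right_semibrace_law : Prop :=
  forall x y z, (z + y) * x = (z + x^*) * x + y * x.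

Definition left_regular_star_semibrace : Prop :=
  [/\ is_semigroup add, regular_star_semigroup mul star & left_semibrace_law].
Definition right_regular_star_semibrace : Prop :=
  [/\ is_semigroup add, regular_star_semigroup mul star & right_semibrace_law].
Definition two_sided_regular_star_semibrace : Prop :=
  left_regular_star_semibrace /\ right_regular_star_semibrace.

End Semibraces.

(* Main.v *)
(* The left law for [a + b = b^* a] unfolds to [x z^* y = x z x^* x y]. Using it
   twice gives [x z^* y = x z y]: stars inside a product can be dropped. With
   [z = a b] this becomes the normality identity [x a b y = x b a y], and with
   [z = x] it gives [x = x x x]; hence part (3). The right law for [+] unfolds to
   [y z x = x^* y x z x]; it makes the projections [x x^*] central, and then
   forces commutativity. Statements on [oplus] are those on [+] in the opposite
   semigroup. *)

Require Import Defs.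
From mathcomp Require Import all_boot.

Set Implicit Arguments.
Unset Strict Implicit.
Unset Printing Implicit Defensive.

Section RegularStar.
Variables (S : Type) (mul : S -> S -> S) (star : S -> S).
Hypothesis hS : regular_star_semigroup mul star.
Local Notation "x * y" := (mul x y).
Local Notation "x ^*" := (star x).
Local Notation add := (star_add mul star).
Local Notation oplus := (star_oplus mul star).

Lemma star_mulA : associative mul.
Proof. by case: hS => -[]. Qed.

Lemma mul_star_mul x : x * x^* * x = x.
Proof. by case: hS. Qed.

Lemma star_involutive : involutive star.
Proof. by case: hS. Qed.

Lemma star_mul x y : (x * y)^* = y^* * x^*.
Proof. by case: hS. Qed.

Lemma star_mul_star x : x^* * x * x^* = x^*.
Proof. by rewrite -{2}(star_involutive x) mul_star_mul. Qed.

(** Source of the duality: over the opposite product, [add a b] becomes [a * b^*], which is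
    [oplus b a]. *)
Lemma opp_regular_star : regular_star_semigroup (fun x y => y * x) star.
Proof.
case: hS => -[iS A] R I M; split=> //=.
- by split=> // x y z; rewrite A.
- by move=> x; rewrite A R.
Qed.

Lemma add_assoc_star_id : associative add -> forall x, x = x^*.
Proof.
move=> addA.
have starl c a : c^* * a = c * a.
  (* The middle term is a self-adjoint projection, so one bracketing collapses to [c * a] and the
     other to [c^* * a]. *)
  have := addA a (c * c^*) c; rewrite /star_add.
  rewrite !(star_mul, star_involutive) !star_mulA.
  by rewrite mul_star_mul star_mul_star.
have starr a c : a * c^* = a * c.
  by apply: (inv_inj star_involutive); rewrite !star_mul star_involutive starl.
by move=> x; rewrite -[LHS]mul_star_mul -[RHS]star_mul_star starl !starr.
Qed.

Lemma star_id_comm : (forall x, x = x^*) -> commutative mul.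
Proof. by move=> sI x y; rewrite [LHS]sI star_mul -!sI. Qed.

Lemma star_id_add_semigroup : (forall x, x = x^*) -> is_semigroup add.
Proof.
move=> sI; have mulC := star_id_comm sI; case: hS => -[iS _] _ _ _; split=> //.
move=> a b c; rewrite /star_add star_mul star_involutive -!sI star_mulA.
by rewrite (mulC b).
Qed.

Lemma add_semigroupP : is_semigroup add <-> (forall x, x = x^*).
Proof.
split; last exact: star_id_add_semigroup.
by case=> _; apply: add_assoc_star_id.
Qed.

Lemma right_law_add_comm : right_semibrace_law add mul star -> commutative mul.
Proof.
move=> law.
have law' x y z : y * z * x = x^* * y * x * z * x.
  have := law x y^* z.
  by rewrite /star_add !(star_mul, star_involutive) !star_mulA.
have absorb e w : e^* = e -> e * e = e -> w * e = e * w * e.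
  by move=> eS ee; have := law' e w e; rewrite eS -!star_mulA !ee.
have projC x y : y * (x * x^*) = x * x^* * y.
  have eS : (x * x^*)^* = x * x^* by rewrite star_mul star_involutive.
  have ee : x * x^* * (x * x^*) = x * x^* by rewrite star_mulA mul_star_mul.
  move: (x * x^*) eS ee => e eS ee.
  (* Starring [absorb] at [y^*] gives [e * y = e * y * e], the mirror image of [absorb] at [y];
     hence [e] is central. *)
  rewrite absorb // -[RHS]star_involutive star_mul eS (absorb e y^*) //.
  by rewrite !star_mul star_involutive eS star_mulA.
have proj'C x y : y * (x^* * x) = x^* * x * y.
  by have := projC x^* y; rewrite star_involutive.
move=> x y.
have conj : x^* * y * x = y * x^* * x.
  by rewrite (law' x y x^*) -!star_mulA (star_mulA x) mul_star_mul.
(* With [x x^*] and [x^* x] central, the two sides of [x x^* y x = x y x^* x] reduce to [y x] and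
   [x y]. *)
have := congr1 (mul x) conj.
rewrite !star_mulA -projC -[X in X = _]star_mulA mul_star_mul => ->.
by rewrite -!star_mulA proj'C !star_mulA mul_star_mul.
Qed.

Lemma comm_right_law_add : commutative mul -> right_semibrace_law add mul star.
Proof.
move=> mulC x y z; rewrite /star_add !(star_mul, star_involutive).
have -> : x^* * y^* * (x * z * x) = y^* * z * (x * x^* * x).
  rewrite -(star_mulA x z) (star_mulA _ x) (mulC (x^* * _)) (mulC x^*) !star_mulA.
  rewrite (mulC x) -!star_mulA; congr mul.
  by rewrite (mulC x^*) !star_mulA (mulC x z) -!star_mulA (mulC x^*).
by rewrite mul_star_mul.
Qed.

Lemma right_law_addP : right_semibrace_law add mul star <-> commutative mul.
Proof. by split; [apply: right_law_add_comm | apply: comm_right_law_add]. Qed.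

Lemma left_law_add_inner_star :
  left_semibrace_law add mul star -> forall x z y, x * z^* * y = x * z * y.
Proof.
move=> law.
have law' x y z : x * z^* * y = x * z * x^* * x * y.
  have := law x y z.
  by rewrite /star_add !(star_mul, star_involutive) !star_mulA.
(* Put [p = x^* x], an idempotent. Then [x z^* y = x z p y], while [law'] at [z^*] and again at [z]
   gives [x z y = x z^* p y = x z p p y]. *)
move=> x z y; rewrite law'.
have := law' x y z^*; rewrite star_involutive => ->.
have := law' x (x^* * x * y) z; rewrite !star_mulA => ->.
by rewrite -2![in RHS](star_mulA (x * z)) star_mul_star.
Qed.

Lemma star_id_left_law_add :
  (forall x, x = x^*) -> left_semibrace_law add mul star.
Proof.
move=> sI x y z; have mulC := star_id_comm sI.
rewrite /star_add -!sI !star_mulA; congr mul.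
rewrite (mulC x z) -!star_mulA; congr mul.
by rewrite -[LHS]mul_star_mul -sI star_mulA.
Qed.

Section InnerStar.
Hypothesis inner_star : forall x z y, x * z^* * y = x * z * y.

(** Starring the inner product [a * b] reverses its factors, and the stars can then be dropped one
    by one. *)
Lemma inner_comm x a b y : x * a * b * y = x * b * a * y.
Proof.
by rewrite -(star_mulA x a) -inner_star star_mul star_mulA !inner_star.
Qed.

Lemma mul_cube x : x * x * x = x.
Proof. by rewrite -inner_star mul_star_mul. Qed.

Lemma inner_star_completely_regular : completely_regular mul.
Proof.
move=> a; split=> x; split=> -[->|[s ->]]; right.
- by exists a; rewrite star_mulA mul_cube.
- by exists (s * a); rewrite -star_mulA (star_mulA a) mul_cube.
- by exists a.
- by exists (s * a); rewrite star_mulA.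
- by exists a; rewrite mul_cube.
- by exists (a * s); rewrite star_mulA mul_cube.
- by exists a.
- by exists (a * s); rewrite star_mulA.
Qed.

Lemma inner_star_orthodox : orthodox mul.
Proof.
move=> e f ee ff; rewrite /idempotent_elt star_mulA (inner_comm e f e f).
by rewrite ee -star_mulA ff.
Qed.

(** Both products begin and end with [e], so [inner_comm] may permute everything in between. *)
Lemma inner_star_local_comm e a b :
  local_subset mul e a -> local_subset mul e b -> a * b = b * a.
Proof.
case=> s -> [t ->]; rewrite !star_mulA.
rewrite (inner_comm (e * s * e) e t) (inner_comm (e * t * e) e s).
rewrite (inner_comm (e * s) e t) (inner_comm e s t).
by rewrite (inner_comm (e * t) e s).
Qed.

Lemma inner_star_locally_inverse : locally_inverse mul.
Proof.
move=> e ee; split.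
- by exists (e * e * e), e.
- by move=> _ _ [s ->] [t ->]; exists (s * e * e * t); rewrite !star_mulA.
(* By [mul_cube] each element is its own inverse; uniqueness will come from commutativity inside
   [e S e]. *)
move=> a Ta; exists a; split; first by split=> //; split; apply: mul_cube.
move=> b [Tb [aba bab]]; have abC := inner_star_local_comm Ta Tb.
(* [a = a a b = a a (a b b) = (a a a) b b = a b b = b] *)
have aab : a * a * b = a by rewrite -star_mulA abC star_mulA.
have abb : a * b * b = b by rewrite abC.
by rewrite -[LHS]aab -{1}abb !star_mulA mul_cube abb.
Qed.

End InnerStar.
End RegularStar.

Theorem proposition3p6 (S : Type) (mul : S -> S -> S) (star : S -> S)
    (hS : regular_star_semigroup mul star) :
  let add := star_add mul star in
  let oplus := star_oplus mul star in
  [/\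
    (is_semigroup add <-> (forall x : S, x = star x)) /\
    (is_semigroup oplus <-> (forall x : S, x = star x)),

    (right_semibrace_law add mul star <-> commutative mul) /\
    (left_semibrace_law oplus mul star <-> commutative mul),

    (left_semibrace_law add mul star ->
      [/\ completely_regular mul, orthodox mul & locally_inverse mul]) /\
    (right_semibrace_law oplus mul star ->
      [/\ completely_regular mul, orthodox mul & locally_inverse mul]) &

    [/\ (forall x : S, x = star x) ->
          [/\ commutative mul,
              left_semibrace_law add mul star &
              right_semibrace_law oplus mul star],
        [/\ left_regular_star_semibrace add mul star <->
              (forall x : S, x = star x),
            right_regular_star_semibrace add mul star <->
              (forall x : S, x = star x) &
            two_sided_regular_star_semibrace add mul star <->
              (forall x : S, x = star x)] &
        [/\ left_regular_star_semibrace oplus mul star <->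
              (forall x : S, x = star x),
            right_regular_star_semibrace oplus mul star <->
              (forall x : S, x = star x) &
            two_sided_regular_star_semibrace oplus mul star <->
              (forall x : S, x = star x)]]].
Proof.
move=> add oplus.
have hop := opp_regular_star hS.
have addP := add_semigroupP hS.
have raddP := right_law_addP hS.
have oplusP : is_semigroup oplus <-> (forall x, x = star x).
  (* The swapped arguments turn associativity into the same equation read from right to left, hence
     [symmetry]. *)
  have [h1 h2] := add_semigroupP hop; split=> [[iS A]|sI].
    by apply: h1; split=> // x y z; symmetry; apply: A.
  by have [iS A] := h2 sI; split=> // x y z; symmetry; apply: A.
have loplusP : left_semibrace_law oplus mul star <-> commutative mul.
  have [h1 h2] := right_law_addP hop; split=> [law|mulC].
    by move=> x y; apply: h1 => u v w; apply: law.
  by move=> x y z; apply: h2 => u v; apply: mulC.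
(* The inner star identity is left-right symmetric, so it can serve for both laws of part (3). *)
have concl : (forall x z y, mul (mul x (star z)) y = mul (mul x z) y) ->
    [/\ completely_regular mul, orthodox mul & locally_inverse mul].
  move=> inner_star; split.
  - exact: inner_star_completely_regular hS inner_star.
  - exact: inner_star_orthodox hS inner_star.
  - exact: inner_star_locally_inverse hS inner_star.
have sI_ladd := star_id_left_law_add hS.
have sI_roplus : (forall x, x = star x) -> right_semibrace_law oplus mul star.
  by move=> sI x y z; apply: star_id_left_law_add hop sI x y z.
have sI_comm := star_id_comm hS.
have ladd : left_regular_star_semibrace add mul star <->
    (forall x, x = star x).
  by split=> [[/addP]|sI] //; split; [apply/addP | | apply: sI_ladd].
have radd : right_regular_star_semibrace add mul star <->
    (forall x, x = star x).
  split=> [[/addP]|sI] //; split; [exact/addP | by [] |].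
  exact/raddP/sI_comm.
have loplus : left_regular_star_semibrace oplus mul star <->
    (forall x, x = star x).
  split=> [[/oplusP]|sI] //; split; [exact/oplusP | by [] |].
  exact/loplusP/sI_comm.
have roplus : right_regular_star_semibrace oplus mul star <->
    (forall x, x = star x).
  by split=> [[/oplusP]|sI] //; split; [apply/oplusP | | apply: sI_roplus].
split=> //.
- split=> law; apply: concl; first exact: left_law_add_inner_star hS law.
  (* The opposite semigroup yields this identity with [x] and [y] exchanged and the product
     bracketed to the right. *)
  move=> x z y; rewrite -!(star_mulA hS).
  by apply: (left_law_add_inner_star hop) => u v w; apply: law.
- split.
  + by move=> sI; split; [apply: sI_comm | apply: sI_ladd | apply: sI_roplus].
  + by split=> //; split=> [[/ladd]|sI] //; split; [apply/ladd | apply/radd].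
  + split=> //; split=> [[/loplus]|sI] //.
    by split; [apply/loplus | apply/roplus].
Qed.
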